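(* Consider complete observations $(X_k,\Phi_k^{(1)},\dots,\Phi_k^{(M)})$, $k=1,\dots,N$, of the mixture process on $[0,T]$, $0<T<\infty$, with log-likelihood function $$\log L=\sum_{k=1}^N\sum_{m=1}^M\Phi_k^{(m)}\Big[\sum_{i=1}^p B_i^{(k)}\log\big(s_i^{(m)}\pi_i\big)+\sum_{i=1}^p\sum_{j\ne i}N_{ij}^{(k)}\log q_{ij}^{(m)}-\sum_{i=1}^p\sum_{j\neq i}q_{ij}^{(m)}Z_i^{(k)}\Big],$$ to be maximized over the parameters $\pi_i\ge 0$, $s_i^{(m)}\ge 0$, $q_{ij}^{(m)}\ge 0$ ($i\neq j$) subject to $\sum_{i=1}^p\pi_i=1$ and $\sum_{m=1}^M s_i^{(m)}=1$ for all $i=1,\dots,p$, with $q_i^{(m)}=\sum_{j\neq i}q_{ij}^{(m)}$. Assume that the denominators below are nonzero. Then the maximum likelihood estimates of $\pi_i$, $q_{ij}^{(m)}$ ($j\ne i$), $q_i^{(m)}$ and $s_i^{(m)}$ are $$\widehat{\pi}_{N,i}=\frac1N\sum_{k=1}^N B_i^{(k)},\qquad \widehat{q}_{N,ij}^{(m)}=\frac{\sum_{k=1}^N\Phi_k^{(m)}N_{ij}^{(k)}}{\sum_{k=1}^N\Phi_k^{(m)}Z_i^{(k)}},$$ $$\widehat{q}_{N,i}^{(m)}=\frac{\sum_{k=1}^N\Phi_k^{(m)}N_{i}^{(k)}}{\sum_{k=1}^N\Phi_k^{(m)}Z_i^{(k)}},\qquad \widehat{s}_{N,i}^{(m)}=\frac{\sum_{k=1}^N\Phi_k^{(m)}B_i^{(k)}}{\sum_{k=1}^N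 B_i^{(k)}}.$$
   Context: State space $\mathbb{S}=\{1,\dots,p\}$, $M$ regimes. The mixture process starts in state $i$ with probability $\pi_i$; given initial state $i$, it selects regime $\phi=m$ with probability $s_i^{(m)}$; given the initial state and $\phi=m$ it evolves as a right-continuous Markov jump process on $\mathbb{S}$ with intensity matrix $\mathbf{Q}^{(m)}=(q_{ij}^{(m)})$, where $q_{ij}^{(m)}\ge0$ for $j\ne i$ and $\sum_{j\neq i}q_{ij}^{(m)}=-q_{ii}^{(m)}=q_i^{(m)}$. $X_1,\dots,X_N$ are $N$ independent realizations of this process observed continuously on $[0,T]$, and under complete information the regime of each is observed. Notation: $\Phi_k^{(m)}\in\{0,1\}$ indicates that $X_k$ is driven by regime $m$ (so $\sum_{m=1}^M\Phi_k^{(m)}=1$); $B_i^{(k)}=\mathbb{1}_{\{X_k(0)=i\}}$ (so $\sum_{i=1}^p B_i^{(k)}=1$); $N_{ij}^{(k)}$ is the number of transitions of $X_k$ from state $i$ to state $j\neq i$ during $[0,T]$; $N_i^{(k)}=\sum_{j\neq i}N_{ij}^{(k)}$; $Z_i^{(k)}=\int_0^T\mathbb{1}_{\{X_k(u)=i\}}\,du$. The convention $0\log 0=0$ is used in the log-likelihood. *)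

(* Defs.v *)
From HB Require Import structures.
From mathcomp Require Import all_boot all_order all_algebra.
From mathcomp Require Import finmap.
From mathcomp Require Import all_classical all_reals all_analysis.

Set Implicit Arguments.
Unset Strict Implicit.
Unset Printing Implicit Defensive.

Import Order.TTheory GRing.Theory Num.Theory.
Import numFieldNormedType.Exports.

Local Open Scope classical_set_scope.
Local Open Scope ring_scope.

(* States are 'I_p, regimes are 'I_M. *)
Record params (R : realType) (p M : nat) := Params {
  init : 'I_p -> R;            (* pi_i *)
  mix : 'I_p -> 'I_M -> R;     (* s_i^(m) *)
  gen : 'I_M -> 'M[R]_p        (* Q^(m) *)
}.

Definition exit_rate (R : realType) (p M : nat) (theta : params R p M)
    (m : 'I_M) (i : 'I_p) : R :=
  \sum_(j < p | j != i) gen theta m i j.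

Definition admissible (R : realType) (p M : nat) (theta : params R p M) : Prop :=
  [/\ (forall i, 0 <= init theta i) /\ \sum_(i < p) init theta i = 1,
      (forall i m, 0 <= mix theta i m) /\
        (forall i, \sum_(m < M) mix theta i m = 1),
      forall m i j, j != i -> 0 <= gen theta m i j &
      forall m i, gen theta m i i = - exit_rate theta m i].

Definition matrix_exp (R : realType) (p : nat) (A : 'M[R]_p) : 'M[R]_p :=
  \matrix_(i, j) limn (series (fun k => (A ^+ k) i j / k`!%:R)).

(* Right-continuous with left limits for the discrete topology on 'I_p; in
   particular finitely many jumps on bounded intervals. *)
Definition jump_path (R : realType) (p : nat) (x : R -> 'I_p) : Prop :=
  (forall t, 0 <= t -> \forall u \near t^'+, x u = x t) /\
  (forall t, 0 < t -> exists i, \forall u \near t^'-, x u = i).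

(* The last clause gives the joint law of the regime and of the states at
   finitely many times: initial state, then regime, then, under regime m, a
   Markov jump process with transition matrices exp (t Q^(m)). *)
Definition mixture_process (R : realType) (p M : nat) (d : measure_display)
    (Omega : measurableType d) (P : probability Omega R)
    (theta : params R p M) (X : R -> Omega -> 'I_p) (phi : Omega -> 'I_M)
    : Prop :=
  [/\ forall w, jump_path (X ^~ w),
      forall t i, 0 <= t -> measurable [set w | X t w = i],
      forall m, measurable [set w | phi w = m] &
      forall (m : 'I_M) (n : nat) (t : nat -> R) (x : nat -> 'I_p),
        t 0%N = 0 -> {homo t : a b / (a <= b)%N >-> a <= b} ->
        P [set w | phi w = m /\ forall l, (l <= n)%N -> X (t l) w = x l] =
        (init theta (x 0%N) * mix theta (x 0%N) m *
         \prod_(0 <= l < n)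
            matrix_exp ((t l.+1 - t l) *: gen theta m) (x l) (x l.+1))%:E].

Definition sigma_obs (R : realType) (p M : nat) (Omega : Type)
    (X : R -> Omega -> 'I_p) (phi : Omega -> 'I_M) : set (set Omega) :=
  <<s [set A | (exists t i, 0 <= t /\ A = [set w | X t w = i]) \/
               (exists m, A = [set w | phi w = m])] >>.

(* The product rule over the whole family suffices: sub-families are obtained
   by taking A k = setT. *)
Definition independent_obs (R : realType) (p M N : nat) (d : measure_display)
    (Omega : measurableType d) (P : probability Omega R)
    (X : 'I_N -> R -> Omega -> 'I_p) (phi : 'I_N -> Omega -> 'I_M) : Prop :=
  forall A : 'I_N -> set Omega,
    (forall k, sigma_obs (X k) (phi k) (A k)) ->
    P [set w | forall k, A k w] = (\prod_(k < N) fine (P (A k)))%:E.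

Section statistics.
Context {R : realType} {p : nat}.
Variables (T : R) (x : R -> 'I_p).

Definition initB (i : 'I_p) : R := (x 0 == i)%:R.

(* A transition from i to j at time t means x(t-) = i and x(t) = j. *)
Definition transitions (i j : 'I_p) : set R :=
  [set t | [/\ 0 < t, t <= T, \forall u \near t^'-, x u = i & x t = j]].

(* fset_set is only meaningful on finite sets; transitions i j is finite for a
   jump_path when i != j. *)
Definition countN (i j : 'I_p) : R := #|` fset_set (transitions i j)|%:R.

Definition exitN (i : 'I_p) : R := \sum_(j < p | j != i) countN i j.

Definition occupZ (i : 'I_p) : R :=
  \int[lebesgue_measure]_(u in `[0, T]) (x u == i)%:R.

End statistics.

Definition regimePhi {R : realType} {M : nat} (r m : 'I_M) : R := (r == m)%:R.

(* In the extended reals lne 0 = -oo and 0 * -oo = 0, which is the convention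
   0 log 0 = 0. *)
Definition loglik (R : realType) (p M N : nat) (T : R)
    (x : 'I_N -> R -> 'I_p) (r : 'I_N -> 'I_M) (theta : params R p M)
    : \bar R :=
  (\sum_(k < N) \sum_(m < M) (regimePhi (r k) m)%:E *
    ((\sum_(i < p) (initB (x k) i)%:E *
        lne (mix theta i m * init theta i)%:E)
     + (\sum_(i < p) \sum_(j < p | j != i) (countN T (x k) i j)%:E *
          lne (gen theta m i j)%:E)
     - (\sum_(i < p) \sum_(j < p | j != i)
          (gen theta m i j * occupZ T (x k) i)%:E)))%E.

Definition is_mle (R : realType) (p M N : nat) (T : R)
    (x : 'I_N -> R -> 'I_p) (r : 'I_N -> 'I_M) (theta : params R p M) : Prop :=
  admissible theta /\
  forall theta', admissible theta' -> (loglik T x r theta' <= loglik T x r theta)%E.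

(* Main.v *)
Require Import Defs.
From mathcomp Require Import all_boot all_order all_algebra.
From mathcomp Require Import all_classical all_reals all_analysis.
From mathcomp Require Import ring lra.
Local Open Scope ring_scope.
Import Order.TTheory GRing.Theory Num.Theory.

(** The log-likelihood separates into one-dimensional problems.  Write
    [poisson_loglik n z y] for [n log y - z y], the log-likelihood of a rate [y]
    when [n] events are seen during an exposure time [z].  The contribution of
    the transition rate from [i] to [j] under regime [m] has this form, [n]
    being the number of such transitions and [z] the time spent in [i], both
    summed over the paths driven by [m].  The initial and mixing probabilities
    only contribute terms [n log y], but since they sum to one, the missing
    linear terms can be added at the price of a constant: with exposure [N] for
    every initial probability, and with the number of paths started in [i] for
    every mixing probability at [i].  These exposures are the Lagrange
    multipliers of the constraints.  Lemma [loglik_poisson] states the resulting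
    identity
      log L = (sum of Poisson log-likelihoods) + 2 N.

    For [z > 0] the inequality [log u <= u - 1], strict for [u <> 1], shows that
    [poisson_loglik n z] has the unique maximizer [n / z] on [y >= 0], with a
    finite maximum ([poisson_loglik_le], [poisson_loglik_argmax]).  The point
    whose coordinates are all these ratios satisfies the constraints, so it
    maximizes the sum.  A sum that reaches a finite sum of termwise upper bounds
    reaches every one of them ([sum_eq_of_le]); hence any other maximizer agrees
    in each coordinate, and also on the diagonals of the intensity matrices,
    which the off-diagonal rates determine. *)

(** * Sums of extended reals that reach an upper bound *)

(** Finiteness is essential: adding [-oo] would hide a strict inequality. *)
Lemma add_eq_of_le {R : realType} {a b a' b' : \bar R} :
  a' \is a fin_num -> b' \is a fin_num -> (a <= a')%E -> (b <= b')%E ->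
  (a' + b' <= a + b)%E -> a = a' /\ b = b'.
Proof.
case: a' => [a'| |] //; case: b' => [b'| |] // _ _.
case: a => [a| |] //; case: b => [b| |] //.
by rewrite -!EFinD !lee_fin => ? ? ?; split; congr _%:E; lra.
Qed.

Lemma sum_eq_of_le {R : realType} {I : finType} (P : pred I) (f g : I -> \bar R) :
  (forall i, P i -> g i \is a fin_num) -> (forall i, P i -> (f i <= g i)%E) ->
  (\sum_(i | P i) g i <= \sum_(i | P i) f i)%E -> forall i, P i -> f i = g i.
Proof.
move=> gfin fg + i Pi; rewrite (bigD1 i) //= [X in (_ <= X)%E](bigD1 i) //=.
move=> ge_sum; have [||||//] := add_eq_of_le _ _ _ _ ge_sum.
- exact: gfin.
- by apply/sum_fin_numP => j _ /andP[/gfin].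
- exact: fg.
- by apply: lee_sum => j /andP[/fg].
Qed.

Lemma sum_indicator {R : realType} {I : finType} (a : I) (f : I -> \bar R) :
  (\sum_(i : I) ((a == i)%:R : R)%:E * f i = f a)%E.
Proof.
rewrite (bigD1 a) //= eqxx mul1e big1 ?adde0 // => i.
by rewrite eq_sym => /negbTE ->; rewrite mul0e.
Qed.

(** * The Poisson log-likelihood and its maximizer *)

(** In the extended reals, so that a rate zero is excluded exactly when events
    have been seen. *)
Definition poisson_loglik {R : realType} (n z y : R) : \bar R :=
  (n%:E * lne y%:E - (z * y)%:E)%E.

Lemma poisson_loglik_gt0 {R : realType} (n z y : R) : 0 < y ->
  poisson_loglik n z y = (n * ln y - z * y)%:E.
Proof. by move=> y0; rewrite /poisson_loglik lne_EFin // -EFinM -EFinB. Qed.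

Lemma poisson_loglik0 {R : realType} (z y : R) :
  poisson_loglik 0 z y = (- (z * y))%:E.
Proof. by rewrite /poisson_loglik mul0e add0e EFinN. Qed.

Lemma poisson_loglik_rate0 {R : realType} (n z : R) : 0 < n ->
  poisson_loglik n z 0 = -oo%E.
Proof. by move=> n0; rewrite /poisson_loglik le0_lneNy // gt0_muleNy ?lte_fin. Qed.

(** This is [log u < u - 1] at [u = z y / n]. *)
Lemma ln_lt_linear {R : realType} (n z y : R) : 0 < n -> 0 < z -> 0 < y ->
  y != n / z -> n * ln y - z * y < n * ln (n / z) - z * (n / z).
Proof.
move=> n0 z0 y0 neq; have nz0 : 0 < n / z by exact: divr_gt0.
set l := ln y - ln (n / z).
have l_neq0 : l != 0.
  by rewrite subr_eq0; apply: contra neq => /eqP /ln_inj ->.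
have := expR_gt1Dx l_neq0; rewrite expRD expRN !lnK ?posrE //.
have -> : y / (n / z) = (z * y) / n by field; rewrite !gt_eqF.
rewrite ltr_pdivlMr // /l => lt_zy.
have -> : z * (n / z) = n by field; rewrite gt_eqF.
by nra.
Qed.

Lemma poisson_loglik_max_fin {R : realType} (n z : R) : 0 <= n -> 0 < z ->
  poisson_loglik n z (n / z) \is a fin_num.
Proof.
rewrite le_eqVlt => /predU1P[<- _|n0 z0]; first by rewrite poisson_loglik0.
by rewrite poisson_loglik_gt0 ?divr_gt0.
Qed.

Lemma poisson_loglik_lt {R : realType} (n z y : R) : 0 <= n -> 0 < z -> 0 <= y ->
  y != n / z -> (poisson_loglik n z y < poisson_loglik n z (n / z))%E.
Proof.
rewrite le_eqVlt => /predU1P[<- z0 y0|n0 z0].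
  rewrite mul0r => y_neq0; rewrite !poisson_loglik0 lte_fin mulr0 oppr0 oppr_lt0.
  by rewrite mulr_gt0 // lt_neqAle eq_sym y_neq0.
rewrite le_eqVlt => /predU1P[<- _|y0 neq].
  by rewrite poisson_loglik_rate0 // poisson_loglik_gt0 ?divr_gt0 // ltNyr.
by rewrite !poisson_loglik_gt0 ?divr_gt0 // lte_fin ln_lt_linear.
Qed.

Lemma poisson_loglik_le {R : realType} (n z y : R) : 0 <= n -> 0 < z -> 0 <= y ->
  (poisson_loglik n z y <= poisson_loglik n z (n / z))%E.
Proof.
move=> n0 z0 y0; have [->//|neq] := eqVneq y (n / z).
exact/ltW/poisson_loglik_lt.
Qed.

Lemma poisson_loglik_argmax {R : realType} (n z y : R) :
  0 <= n -> 0 < z -> 0 <= y ->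
  poisson_loglik n z y = poisson_loglik n z (n / z) -> y = n / z.
Proof.
move=> n0 z0 y0 eq_max; apply/eqP; apply: contraTT isT => neq.
by have := poisson_loglik_lt _ _ _ n0 z0 y0 neq; rewrite eq_max ltxx.
Qed.

(** The coordinates are maximized independently, and finiteness of the
    maximum lets equality of the sums pass to the coordinates. *)
Lemma sum_poisson_max {R : realType} {I : finType} (P : pred I)
    (n z y : I -> R) :
  (forall i, P i -> [/\ 0 <= n i, 0 < z i & 0 <= y i]) ->
  let L q := (\sum_(i | P i) poisson_loglik (n i) (z i) (q i))%E in
  let yhat i := n i / z i in
  [/\ L yhat \is a fin_num, (L y <= L yhat)%E &
      (L yhat <= L y)%E -> forall i, P i -> y i = n i / z i].
Proof.
move=> nzy L yhat; split.
- by apply/sum_fin_numP => i _ /nzy[n0 z0 _]; exact: poisson_loglik_max_fin.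
- by apply: lee_sum => i /nzy[n0 z0 y0]; exact: poisson_loglik_le.
- move=> ge_sum i Pi; have [n0 z0 y0] := nzy i Pi.
  apply: poisson_loglik_argmax => //; move: i Pi {n0 z0 y0}.
  apply: sum_eq_of_le ge_sum => i /nzy[n0 z0 y0].
  + exact: poisson_loglik_max_fin.
  + exact: poisson_loglik_le.
Qed.

(** Independent observations of the same rate pool their events and their
    exposures. *)
Lemma poisson_loglik_sum {R : realType} {I : finType} (n z : I -> R) (y : R) :
  (forall k, 0 <= n k) ->
  (\sum_k poisson_loglik (n k) (z k) y =
     poisson_loglik (\sum_k n k) (\sum_k z k) y)%E.
Proof.
move=> n0; rewrite /poisson_loglik big_split /=; congr (_ + _)%E.
  by rewrite -sumEFin ge0_sume_distrl // => k _; rewrite lee_fin.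
by rewrite sumEFin sumrN -mulr_suml EFinN.
Qed.

(** * Sufficient statistics *)

Lemma initB_ge0 {R : realType} {p : nat} (x : R -> 'I_p) (i : 'I_p) :
  0 <= initB x i.
Proof. exact: ler0n. Qed.

Lemma regimePhi_ge0 {R : realType} {M : nat} (r m : 'I_M) :
  0 <= regimePhi r m :> R.
Proof. exact: ler0n. Qed.

Lemma sum_initB {R : realType} {p : nat} (x : R -> 'I_p) :
  \sum_(i < p) initB x i = 1.
Proof.
rewrite (bigD1 (x 0)) //= /initB eqxx big1 ?addr0 // => i.
by rewrite eq_sym => /negbTE ->.
Qed.

Lemma sum_regimePhi {R : realType} {M : nat} (r : 'I_M) :
  \sum_(m < M) regimePhi r m = 1 :> R.
Proof.
rewrite (bigD1 r) //= /regimePhi eqxx big1 ?addr0 // => m.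
by rewrite eq_sym => /negbTE ->.
Qed.

Lemma occupZ_ge0 {R : realType} {p : nat} (T : R) (x : R -> 'I_p) (i : 'I_p) :
  0 <= occupZ T x i.
Proof. by apply: Rintegral_ge0 => u _; exact: ler0n. Qed.

(** A vanishing factor gives [-oo] on both sides, since neither logarithm can be
    [+oo]. *)
Lemma lneM_ge0 {R : realType} (s q : R) : 0 <= s -> 0 <= q ->
  (lne (s * q)%:E = lne s%:E + lne q%:E)%E.
Proof.
have lne0 : lne (0%:E : \bar R) = -oo%E by rewrite le0_lneNy.
rewrite le_eqVlt => /predU1P[<-|s0]; first by rewrite mul0r lne0 addNye.
rewrite le_eqVlt => /predU1P[<-|q0]; first by rewrite mulr0 lne0 addeNy.
by rewrite !lne_EFin ?mulr_gt0 // lnM ?posrE.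
Qed.

(** * The log-likelihood as a sum of Poisson log-likelihoods *)

(** One path started in [x 0] is one event of the parameter [q (x 0)]; a unit
    exposure of every state costs the constant [1] because [q] sums to one. *)
Lemma sum_init_poisson {R : realType} {p : nat} (x : R -> 'I_p) (q : 'I_p -> R) :
  \sum_(i < p) q i = 1 ->
  (\sum_(i < p) poisson_loglik (initB x i) 1 (q i) = lne (q (x 0%R))%:E - 1%:E)%E.
Proof.
move=> q1; rewrite /poisson_loglik big_split /= sum_indicator; congr (_ + _)%E.
under eq_bigr do rewrite mul1r.
by rewrite sumEFin sumrN q1 EFinN.
Qed.

(** Only the initial state [x 0] has nonzero exposure: the choice of the regime
    carries information on the mixing probabilities of that state alone. *)
Lemma sum_mix_poisson {R : realType} {p M : nat} (x : R -> 'I_p) (r : 'I_M)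
    (s : 'I_p -> 'I_M -> R) :
  (forall i, \sum_(m < M) s i m = 1) ->
  (\sum_(i < p) \sum_(m < M)
     poisson_loglik (regimePhi r m * initB x i) (initB x i) (s i m) =
   lne (s (x 0%R) r)%:E - 1%:E)%E.
Proof.
move=> s1; rewrite -[RHS](sum_indicator (x 0)
  (fun i => lne (s i r)%:E - 1%:E)%E); apply: eq_bigr => i _.
rewrite /initB; case: eqP => _; last first.
  by rewrite mul0e big1 // => m _; rewrite mulr0 poisson_loglik0 mul0r oppr0.
rewrite mul1e /poisson_loglik big_split /=; congr (_ + _)%E.
  under eq_bigr do rewrite mulr1.
  exact: sum_indicator.
under eq_bigr do rewrite mul1r.
by rewrite sumEFin sumrN s1 EFinN.
Qed.

Lemma sum_gen_poisson {R : realType} {p M : nat} (r : 'I_M)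
    (n : 'I_p -> 'I_p -> R) (z : 'I_p -> R) (q : 'I_M -> 'M[R]_p) :
  (\sum_(m < M) \sum_(i < p) \sum_(j < p | j != i)
     poisson_loglik (regimePhi r m * n i j) (regimePhi r m * z i) (q m i j) =
   \sum_(i < p) \sum_(j < p | j != i) (n i j)%:E * lne (q r i j)%:E
   - \sum_(i < p) \sum_(j < p | j != i) (q r i j * z i)%:E)%E.
Proof.
rewrite (bigD1 r) //= [X in (_ + X)%E]big1 ?adde0; last first.
  move=> m; rewrite /regimePhi eq_sym => /negbTE ->.
  by do 2![rewrite big1 // => ? _]; rewrite !mul0r poisson_loglik0 mul0r oppr0.
under [X in (_ = _ - X)%E]eq_bigr do rewrite sumEFin.
rewrite sumEFin -EFinN -sumrN -sumEFin -big_split /=; apply: eq_bigr => i _.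
rewrite -sumrN -sumEFin -big_split /=; apply: eq_bigr => j _.
by rewrite /regimePhi eqxx !mul1r /poisson_loglik EFinN (mulrC (z i)).
Qed.

(** The three blocks of parameters, with the events and the exposures pooled
    over the [N] observations. *)
Definition init_part {R : realType} {p N : nat} (x : 'I_N -> R -> 'I_p)
    (q : 'I_p -> R) : \bar R :=
  (\sum_(i < p) poisson_loglik (\sum_(k < N) initB (x k) i) N%:R (q i))%E.

Definition mix_part {R : realType} {p M N : nat} (x : 'I_N -> R -> 'I_p)
    (r : 'I_N -> 'I_M) (s : 'I_p -> 'I_M -> R) : \bar R :=
  (\sum_(i < p) \sum_(m < M)
     poisson_loglik (\sum_(k < N) regimePhi (r k) m * initB (x k) i)
       (\sum_(k < N) initB (x k) i) (s i m))%E.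

Definition gen_part {R : realType} {p M N : nat} (T : R) (x : 'I_N -> R -> 'I_p)
    (r : 'I_N -> 'I_M) (q : 'I_M -> 'M[R]_p) : \bar R :=
  (\sum_(m < M) \sum_(i < p) \sum_(j < p | j != i)
     poisson_loglik (\sum_(k < N) regimePhi (r k) m * countN T (x k) i j)
       (\sum_(k < N) regimePhi (r k) m * occupZ T (x k) i) (q m i j))%E.

(** Each observation carries two constraints, one on its initial state and one
    on its regime, whence the constant [2 N]. *)
Lemma loglik_poisson {R : realType} {p M N : nat} (T : R)
    (x : 'I_N -> R -> 'I_p) (r : 'I_N -> 'I_M) (theta : params R p M) :
  admissible theta ->
  (loglik T x r theta =
     init_part x (init theta) + mix_part x r (mix theta)
     + gen_part T x r (gen theta) + (2 * N%:R)%:E)%E.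
Proof.
move=> [[pi0 pi1] [s0 s1] _ _].
have -> : init_part x (init theta) =
    (\sum_(k < N) \sum_(i < p) poisson_loglik (initB (x k) i) 1 (init theta i))%E.
  rewrite exchange_big /=; apply: eq_bigr => i _.
  rewrite poisson_loglik_sum => [|k]; last exact: initB_ge0.
  by rewrite sumr_const card_ord.
have -> : mix_part x r (mix theta) = (\sum_(k < N) \sum_(i < p) \sum_(m < M)
    poisson_loglik (regimePhi (r k) m * initB (x k) i)
      (initB (x k) i) (mix theta i m))%E.
  rewrite exchange_big /=; apply: eq_bigr => i _.
  rewrite exchange_big /=; apply: eq_bigr => m _.
  by rewrite poisson_loglik_sum // => k; rewrite mulr_ge0 ?regimePhi_ge0 ?initB_ge0.
have -> : gen_part T x r (gen theta) =
    (\sum_(k < N) \sum_(m < M) \sum_(i < p) \sum_(j < p | j != i)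
    poisson_loglik (regimePhi (r k) m * countN T (x k) i j)
      (regimePhi (r k) m * occupZ T (x k) i) (gen theta m i j))%E.
  rewrite exchange_big /=; apply: eq_bigr => m _.
  rewrite exchange_big /=; apply: eq_bigr => i _.
  rewrite exchange_big /=; apply: eq_bigr => j _.
  by rewrite poisson_loglik_sum // => k; rewrite mulr_ge0 ?regimePhi_ge0 ?ler0n.
have -> : ((2 * N%:R)%:E = \sum_(k < N) (1%:E + 1%:E) :> \bar R)%E.
  by rewrite sumEFin sumr_const card_ord mulr_natr.
rewrite -!big_split /=; apply: eq_bigr => k _.
rewrite sum_init_poisson // sum_mix_poisson // sum_gen_poisson.
rewrite sum_indicator /initB sum_indicator lneM_ge0 //.
rewrite -[LHS]addeA; move: (lne _) (lne _) (_ - _)%E => [b| |] [a| |] [c| |] //=.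
by rewrite -!(EFinD, EFinN); congr _%:E; ring.
Qed.

(** * Existence and uniqueness of the maximizer *)

(** Events over exposure, for every parameter; the diagonal is the one that
    admissibility prescribes. *)
Definition mle {R : realType} {p M N : nat} (T : R) (x : 'I_N -> R -> 'I_p)
    (r : 'I_N -> 'I_M) : params R p M :=
  let rate m i j := (\sum_(k < N) regimePhi (r k) m * countN T (x k) i j) /
                    (\sum_(k < N) regimePhi (r k) m * occupZ T (x k) i) in
  {| init := fun i => (\sum_(k < N) initB (x k) i) / N%:R;
     mix := fun i m => (\sum_(k < N) regimePhi (r k) m * initB (x k) i) /
                       (\sum_(k < N) initB (x k) i);
     gen := fun m => \matrix_(i, j)
       (if j == i then - \sum_(l < p | l != i) rate m i l else rate m i j) |}.

Lemma mle_gen {R : realType} {p M N : nat} (T : R) (x : 'I_N -> R -> 'I_p)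
    (r : 'I_N -> 'I_M) m i j : j != i ->
  gen (mle T x r) m i j =
    (\sum_(k < N) regimePhi (r k) m * countN T (x k) i j) /
    (\sum_(k < N) regimePhi (r k) m * occupZ T (x k) i).
Proof. by move=> /negbTE ji; rewrite mxE ji. Qed.

Lemma mle_exit_rate {R : realType} {p M N : nat} (T : R) (x : 'I_N -> R -> 'I_p)
    (r : 'I_N -> 'I_M) m i :
  exit_rate (mle T x r) m i =
    (\sum_(k < N) regimePhi (r k) m * exitN T (x k) i) /
    (\sum_(k < N) regimePhi (r k) m * occupZ T (x k) i).
Proof.
rewrite /exit_rate (eq_bigr _ (fun j ji => mle_gen T x r m i j ji)).
rewrite -mulr_suml exchange_big /=; congr (_ / _).
by apply: eq_bigr => k _; rewrite -mulr_sumr.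
Qed.

Section maximizer.
Context {R : realType} {p M N : nat}.
Variables (T : R) (x : 'I_N -> R -> 'I_p) (r : 'I_N -> 'I_M).
Hypothesis N_gt0 : (0 < N)%N.
Hypothesis starts_neq0 : forall i, \sum_(k < N) initB (x k) i != 0 :> R.
Hypothesis exposure_neq0 :
  forall i m, \sum_(k < N) regimePhi (r k) m * occupZ T (x k) i != 0.

Let starts_gt0 i : 0 < \sum_(k < N) initB (x k) i :> R.
Proof.
by rewrite lt_neqAle eq_sym starts_neq0 sumr_ge0 // => k _; exact: initB_ge0.
Qed.

Let exposure_gt0 m i : 0 < \sum_(k < N) regimePhi (r k) m * occupZ T (x k) i.
Proof.
rewrite lt_neqAle eq_sym exposure_neq0 sumr_ge0 // => k _.
by rewrite mulr_ge0 ?regimePhi_ge0 ?occupZ_ge0.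
Qed.

Let regime_starts_ge0 m i : 0 <= \sum_(k < N) regimePhi (r k) m * initB (x k) i :> R.
Proof. by apply: sumr_ge0 => k _; rewrite mulr_ge0 ?regimePhi_ge0 ?initB_ge0. Qed.

Let events_ge0 m i j :
  0 <= \sum_(k < N) regimePhi (r k) m * countN T (x k) i j :> R.
Proof. by apply: sumr_ge0 => k _; rewrite mulr_ge0 ?regimePhi_ge0 ?ler0n. Qed.

Lemma mle_admissible : admissible (mle T x r).
Proof.
split=> [||m i j ji|m i].
- split=> [i|]; first by rewrite divr_ge0 ?ler0n // ltW.
  rewrite -mulr_suml exchange_big /=.
  under eq_bigr do rewrite sum_initB.
  by rewrite sumr_const card_ord divff // pnatr_eq0 -lt0n.
- split=> i => [m|]; first by rewrite divr_ge0 // ltW.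
  rewrite -mulr_suml exchange_big /=.
  under eq_bigr do rewrite -mulr_suml sum_regimePhi mul1r.
  by rewrite divff.
- by rewrite mle_gen // divr_ge0 // ltW.
- rewrite mxE eqxx; congr (- _).
  by apply: eq_bigr => j /negbTE ji; rewrite mxE ji.
Qed.

Lemma init_part_max (q : 'I_p -> R) : (forall i, 0 <= q i) ->
  let qhat := init (mle T x r) in
  [/\ init_part x qhat \is a fin_num, (init_part x q <= init_part x qhat)%E &
      (init_part x qhat <= init_part x q)%E -> forall i, q i = qhat i].
Proof.
move=> q0; have [i _|fin le arg] := sum_poisson_max predT
    (fun i => \sum_(k < N) initB (x k) i) (fun=> N%:R) q.
  by split=> //; [exact: ltW|rewrite ltr0n].
by split=> // /arg + i; exact.
Qed.

Lemma mix_part_max (s : 'I_p -> 'I_M -> R) : (forall i m, 0 <= s i m) ->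
  let shat := mix (mle T x r) in
  [/\ mix_part x r shat \is a fin_num,
      (mix_part x r s <= mix_part x r shat)%E &
      (mix_part x r shat <= mix_part x r s)%E -> forall i m, s i m = shat i m].
Proof.
move=> s0; rewrite /mix_part !pair_bigA /=.
have [a _|fin le arg] := sum_poisson_max predT
    (fun a : 'I_p * 'I_M => \sum_(k < N) regimePhi (r k) a.2 * initB (x k) a.1)
    (fun a => \sum_(k < N) initB (x k) a.1) (fun a => s a.1 a.2).
  by split.
by split=> // /arg + i m => /(_ (i, m)); exact.
Qed.

Lemma gen_part_max (q : 'I_M -> 'M[R]_p) :
  (forall m i j, j != i -> 0 <= q m i j) ->
  let qhat := gen (mle T x r) in
  [/\ gen_part T x r qhat \is a fin_num,
      (gen_part T x r q <= gen_part T x r qhat)%E &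
      (gen_part T x r qhat <= gen_part T x r q)%E ->
        forall m i j, j != i -> q m i j = qhat m i j].
Proof.
move=> q0 qhat.
pose z (a : 'I_M * ('I_p * 'I_p)) :=
  \sum_(k < N) regimePhi (r k) a.1 * occupZ T (x k) a.2.1.
pose n (a : 'I_M * ('I_p * 'I_p)) :=
  \sum_(k < N) regimePhi (r k) a.1 * countN T (x k) a.2.1 a.2.2.
have flat (h : 'I_M -> 'M[R]_p) : gen_part T x r h =
    (\sum_(a | a.2.2 != a.2.1) poisson_loglik (n a) (z a) (h a.1 a.2.1 a.2.2))%E.
  rewrite /gen_part; under eq_bigr do rewrite pair_big_dep /=.
  by rewrite pair_big_dep.
have [a Pa|] := sum_poisson_max (fun a => a.2.2 != a.2.1) n z
    (fun a => q a.1 a.2.1 a.2.2).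
  by split; [exact: events_ge0|exact: exposure_gt0|exact: q0].
rewrite !flat; under eq_bigr => a Pa do rewrite -mle_gen //.
move=> fin le arg; split=> // /arg + m i j ji => /(_ (m, (i, j)) ji) /= ->.
by rewrite /qhat mle_gen.
Qed.

Lemma mle_is_mle : is_mle T x r (mle T x r).
Proof.
split=> [|theta adm]; first exact: mle_admissible.
rewrite !loglik_poisson //; last exact: mle_admissible.
case: adm => -[q0 _] [s0 _] g0 _.
have [_ ? _] := init_part_max _ q0.
have [_ ? _] := mix_part_max _ s0.
have [_ ? _] := gen_part_max _ g0.
by rewrite !leeD.
Qed.

Lemma mle_unique (theta : params R p M) : is_mle T x r theta -> theta = mle T x r.
Proof.
move=> [adm /(_ _ mle_admissible)].
rewrite !loglik_poisson //; last exact: mle_admissible.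
rewrite leeD2rE //.
case: theta adm => q s g [[/= q0 _] [s0 _] g0 diag].
have [qfin qle qarg] := init_part_max _ q0.
have [sfin sle sarg] := mix_part_max _ s0.
have [gfin gle garg] := gen_part_max _ g0.
have qsfin : (init_part x (init (mle T x r)) + mix_part x r (mix (mle T x r)))%E
    \is a fin_num by rewrite fin_numD qfin.
move=> /(add_eq_of_le qsfin gfin (leeD qle sle) gle)[eq_qs eq_g].
have [|eq_q eq_s] := add_eq_of_le qfin sfin qle sle; first by rewrite eq_qs.
have off m i j : j != i -> g m i j = gen (mle T x r) m i j.
  by apply: garg; rewrite eq_g.
have -> : q = init (mle T x r) by apply/funext/qarg; rewrite eq_q.
have -> : s = mix (mle T x r).
  by apply/funext => i; apply/funext/sarg; rewrite eq_s.
have -> : g = gen (mle T x r); last by [].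
apply/funext => m; apply/matrixP => i j.
(* Admissibility makes each diagonal entry minus the sum of the others in its row. *)
have [->|] := eqVneq j i; last exact: off.
have [_ _ _ ->] := mle_admissible; rewrite diag; congr (- _).
by apply: eq_bigr => l; exact: off.
Qed.

End maximizer.

Theorem theorem3p1 (R : realType) (p M N : nat) (T : R)
    (d : measure_display) (Omega : measurableType d) (P : probability Omega R)
    (theta0 : params R p M)
    (X : 'I_N -> R -> Omega -> 'I_p) (phi : 'I_N -> Omega -> 'I_M)
    (hT : 0 < T)
    (htheta0 : admissible theta0)
    (hX : forall k, mixture_process P theta0 (X k) (phi k))
    (hindep : independent_obs P X phi)
    (w : Omega) :
  let x : 'I_N -> R -> 'I_p := fun k t => X k t w in
  let r : 'I_N -> 'I_M := fun k => phi k w in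
  (0 < N)%N ->
  (forall i, \sum_(k < N) initB (x k) i != 0 :> R) ->
  (forall i m, \sum_(k < N) regimePhi (r k) m * occupZ T (x k) i != 0) ->
  exists theta : params R p M,
    [/\ is_mle T x r theta /\
          (forall theta', is_mle T x r theta' -> theta' = theta),
        forall i, init theta i = N%:R^-1 * \sum_(k < N) initB (x k) i,
        forall m i j, j != i ->
          gen theta m i j =
            (\sum_(k < N) regimePhi (r k) m * countN T (x k) i j) /
            (\sum_(k < N) regimePhi (r k) m * occupZ T (x k) i),
        forall m i,
          exit_rate theta m i =
            (\sum_(k < N) regimePhi (r k) m * exitN T (x k) i) /
            (\sum_(k < N) regimePhi (r k) m * occupZ T (x k) i) &
        forall m i,
          mix theta i m =
            (\sum_(k < N) regimePhi (r k) m * initB (x k) i) /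
            (\sum_(k < N) initB (x k) i)].
Proof.
move=> x r N_gt0 starts exposure; exists (mle T x r); split.
- split; [exact: mle_is_mle|exact: mle_unique].
- by move=> i; rewrite mulrC.
- exact: mle_gen.
- exact: mle_exit_rate.
- by [].
Qed.
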